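(* Let $R$ be the pullback ring of ring epimorphisms $R_1\xrightarrow{v_1}\overline R\xleftarrow{v_2}R_2$. Every pullback $R$-module $S$ has a separated diagram $S_1\xrightarrow{p_1}\overline S\xleftarrow{p_2}S_2$, and this diagram is unique up to isomorphism: if $T_1\xrightarrow{q_1}\overline T\xleftarrow{q_2}T_2$ is another separated diagram for $S$, then there are $R_i$-linear isomorphisms $f_i\colon S_i\to T_i$ ($i=1,2$) and an $\overline R$-linear isomorphism $\bar f\colon\overline S\to\overline T$ with $q_if_i=\bar fp_i$ for $i=1,2$.
   Context: Rings are unital and modules are (left) modules. $v_1,v_2$ are surjective ring homomorphisms, $R=\{(r_1,r_2)\in R_1\oplus R_2: v_1(r_1)=v_2(r_2)\}$, and $P_i=\ker v_i$. Any $\overline R$-module is an $R_i$-module via $v_i$. Given $R_i$-modules $S_i$ ($i=1,2$), an $\overline R$-module $\overline S$ and $R_i$-linear maps $p_i\colon S_i\to\overline S$, the pullback $\{(s_1,s_2): p_1(s_1)=p_2(s_2)\}$ is an $R$-module by $(r_1,r_2)(s_1,s_2)=(r_1s_1,r_2s_2)$. An $R$-module $S$ isomorphic to such a pullback is called a pullback module, and $S_1\xrightarrow{p_1}\overline S\xleftarrow{p_2}S_2$ is a pullback diagram for $S$. The diagram is separated if each $p_i$ is surjective and $\ker p_i=P_iS_i$; a separated diagram for $S$ is a pullback diagram for $S$ that is separated. *)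

(* Defs.v *)
From HB Require Import structures.
From mathcomp Require Import all_boot all_order all_algebra.

Set Implicit Arguments.
Unset Strict Implicit.
Unset Printing Implicit Defensive.

Import GRing.Theory.
Local Open Scope ring_scope.

Definition surjective (A B : Type) (f : A -> B) : Prop :=
  forall y : B, exists x : A, f x = y.

Section PullbackRing.
Variables (R1 R2 Rbar : pzRingType).
Variables (v1 : {rmorphism R1 -> Rbar}) (v2 : {rmorphism R2 -> Rbar}).

Definition in_pullback_ring : pred (R1 * R2) := fun r => v1 r.1 == v2 r.2.

Fact in_pullback_ring_closed : subring_closed in_pullback_ring.
Proof.
split; rewrite /in_mem /=.
- by rewrite /in_pullback_ring /= !rmorph1.
- by move=> x y /eqP xP /eqP yP; rewrite /in_mem /= /in_pullback_ring /= !rmorphB xP yP.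
- by move=> x y /eqP xP /eqP yP; rewrite /in_mem /= /in_pullback_ring /= !rmorphM xP yP.
Qed.

Record pullback_ring : Type := PullbackRing {
  pullback_ring_val : R1 * R2;
  _ : in_pullback_ring pullback_ring_val }.

HB.instance Definition _ := [isSub for pullback_ring_val].
HB.instance Definition _ := [Choice of pullback_ring by <:].
HB.instance Definition _ :=
  GRing.SubChoice_isSubPzRing.Build (R1 * R2)%type in_pullback_ring
    pullback_ring in_pullback_ring_closed.

(* An [Rbar]-module is an [Ri]-module via [vi]; accordingly [Ri]-linearity of
   a map into it is linearity for the scaling operator [vi \; *:%R], that is
   [p (r *: s) = vi r *: p s]. *)
Record pullback_diagram : Type := PullbackDiagram {
  pd1 : lmodType R1;
  pd2 : lmodType R2;
  pdbar : lmodType Rbar;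
  pdmap1 : {linear pd1 -> pdbar | v1 \; *:%R};
  pdmap2 : {linear pd2 -> pdbar | v2 \; *:%R} }.

End PullbackRing.

Section PullbackModule.
Variables (R1 R2 Rbar : pzRingType).
Variables (v1 : {rmorphism R1 -> Rbar}) (v2 : {rmorphism R2 -> Rbar}).
Variable D : pullback_diagram v1 v2.

Definition in_pullback : pred (pd1 D * pd2 D) :=
  fun s => pdmap1 D s.1 == pdmap2 D s.2.

Fact in_pullback_closed : zmod_closed in_pullback.
Proof.
split; rewrite /in_mem /=.
- by rewrite /in_pullback /= !raddf0.
- by move=> x y /eqP xP /eqP yP; rewrite /in_mem /= /in_pullback /= !raddfB /= xP yP.
Qed.

Record pullback : Type := Pullback {
  pullback_val : pd1 D * pd2 D;
  _ : in_pullback pullback_val }.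

HB.instance Definition _ := [isSub for pullback_val].
HB.instance Definition _ := [Choice of pullback by <:].
HB.instance Definition _ :=
  GRing.SubChoice_isSubZmodule.Build (pd1 D * pd2 D)%type in_pullback
    pullback in_pullback_closed.

Fact pullback_scale_subproof (r : pullback_ring v1 v2) (s : pullback) :
  in_pullback ((val r).1 *: (val s).1, (val r).2 *: (val s).2).
Proof.
case: r s => r /= /eqP rP [s /= /eqP sP].
by rewrite /in_mem /= /in_pullback /= !linearZ_LR /= rP sP.
Qed.

Definition pullback_scale (r : pullback_ring v1 v2) (s : pullback) : pullback :=
  Pullback (pullback_scale_subproof r s).

Fact pullback_scaleA a b (s : pullback) :
  pullback_scale a (pullback_scale b s) = pullback_scale (a * b) s.
Proof. by apply: val_inj; rewrite /= !scalerA. Qed.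

Fact pullback_scale1 : left_id 1 pullback_scale.
Proof. by move=> s; apply: val_inj; rewrite /= !scale1r; case: (val s). Qed.

Fact pullback_scaleDr : right_distributive pullback_scale +%R.
Proof. by move=> a s t; apply: val_inj; rewrite /= !scalerDr. Qed.

Fact pullback_scaleDl s : {morph pullback_scale^~ s : a b / a + b}.
Proof. by move=> a b; apply: val_inj; rewrite /= !scalerDl. Qed.

HB.instance Definition _ :=
  GRing.Zmodule_isLmodule.Build (pullback_ring v1 v2) pullback
    pullback_scaleA pullback_scale1 pullback_scaleDr pullback_scaleDl.

End PullbackModule.

(* Membership in [(ker v) M], the finite sums of products [r *: m] with
   [v r = 0]. *)
Definition in_ker_smul (A B : pzRingType) (v : {rmorphism A -> B})
    (M : lmodType A) (x : M) : Prop :=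
  exists (n : nat) (r : 'I_n -> A) (m : 'I_n -> M),
    (forall k, v (r k) = 0) /\ x = \sum_(k < n) r k *: m k.

Section Diagrams.
Variables (R1 R2 Rbar : pzRingType).
Variables (v1 : {rmorphism R1 -> Rbar}) (v2 : {rmorphism R2 -> Rbar}).

Definition diagram_for (S : lmodType (pullback_ring v1 v2))
    (D : pullback_diagram v1 v2) : Prop :=
  exists f : {linear S -> pullback D}, bijective f.

Definition pullback_module (S : lmodType (pullback_ring v1 v2)) : Prop :=
  exists D : pullback_diagram v1 v2, diagram_for S D.

Definition separated (D : pullback_diagram v1 v2) : Prop :=
  [/\ surjective (pdmap1 D),
      surjective (pdmap2 D),
      forall s, pdmap1 D s = 0 <-> in_ker_smul v1 s
    & forall s, pdmap2 D s = 0 <-> in_ker_smul v2 s].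

Definition separated_diagram_for (S : lmodType (pullback_ring v1 v2))
    (D : pullback_diagram v1 v2) : Prop :=
  diagram_for S D /\ separated D.

Definition diagram_iso (D E : pullback_diagram v1 v2) : Prop :=
  exists (f1 : {linear pd1 D -> pd1 E}) (f2 : {linear pd2 D -> pd2 E})
         (fbar : {linear pdbar D -> pdbar E}),
    [/\ bijective f1, bijective f2, bijective fbar,
        forall s, pdmap1 E (f1 s) = fbar (pdmap1 D s)
      & forall s, pdmap2 E (f2 s) = fbar (pdmap2 D s)].

End Diagrams.

(* Main.v *)
Require Import Defs.
From HB Require Import structures.
From mathcomp Require Import all_boot all_order all_algebra boolp.

Set Implicit Arguments.
Unset Strict Implicit.
Unset Printing Implicit Defensive.

Import GRing.Theory.
Local Open Scope ring_scope.

(** Write [M / (ker w) M] for the reduction of an [A]-module [M] along a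
surjective ring morphism [w : A -> B].  It is a [B]-module, it represents the
semilinear maps out of [M], and it is characterized up to isomorphism as a
surjective semilinear map with kernel [(ker w) M].

Let [rho1], [rho2] be the projections of the pullback ring [R], and [rhobar]
the common composite [v1 \o rho1 = v2 \o rho2].  The separated diagram of [S]
can only consist of the reductions of [S] along [rho1], [rho2] and [rhobar].

Uniqueness: let [D] be separated and [S] its pullback.  If the first coordinate
of [s] vanishes, its second coordinate lies in [ker p2 = P2 S2], so [s] is a
combination with coefficients in [ker rho1 = 0 x P2] ([reduction_coordinate]);
hence [S -> S1] is the reduction along [rho1].  Symmetrically for [S2].
Composing with [p1], whose kernel is [P1 S1], shows that [S -> Sbar] is the
reduction along [rhobar] ([reduction_comp]).  Two separated diagrams therefore
consist of three pairs of reductions of the same module, and the isomorphisms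
of [reduction_unique] commute with the maps out of [S], hence with the [p_i].

Existence: take the three reductions of [S], with the maps that their universal
property provides.  These maps have the right kernels ([reduction_descent]).
Since [ker rhobar = P1 x P2 = ker rho1 + ker rho2], every compatible pair of
classes comes from an element of [S]; this element is unique because
[(ker rho1) S] and [(ker rho2) S] meet in [0]: in any pullback diagram for [S],
combinations with coefficients in [ker rho1] have first coordinate [0], and
combinations with coefficients in [ker rho2] have second coordinate [0]. *)

(** * Bijections and the submodule [(ker w) M] *)

Lemma inj_surj_bijective (T U : choiceType) (f : T -> U) :
  injective f -> surjective f -> bijective f.
Proof.
move=> f_inj f_surj.
have ex y : exists x, f x == y by have [x /eqP] := f_surj y; exists x.
have fK y : f (xchoose (ex y)) = y by exact/eqP/(xchooseP (ex y)).
by exists (fun y => xchoose (ex y)) => // x; apply: f_inj.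
Qed.

Section KerSmul.
Variables (A B : pzRingType) (w : {rmorphism A -> B}) (M : lmodType A).

Lemma in_ker_smul0 : in_ker_smul w (0 : M).
Proof. by exists 0, (fun=> 0), (fun=> 0); split; [case | rewrite big_ord0]. Qed.

Lemma in_ker_smulD (x y : M) :
  in_ker_smul w x -> in_ker_smul w y -> in_ker_smul w (x + y).
Proof.
move=> [n [r [m [r0 ->]]]] [n' [r' [m' [r0' ->]]]].
exists (n + n')%N,
  (fun k => match split k with inl i => r i | inr j => r' j end),
  (fun k => match split k with inl i => m i | inr j => m' j end); split.
  by move=> k; case: (split k).
rewrite big_split_ord; congr (_ + _); apply: eq_bigr => i _.
  by rewrite (unsplitK (inl i)).
by rewrite (unsplitK (inr i)).
Qed.

Lemma in_ker_smulZ (a : A) (x : M) : in_ker_smul w x -> in_ker_smul w (a *: x).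
Proof.
move=> [n [r [m [r0 ->]]]]; exists n, (fun k => a * r k), m; split.
  by move=> k; rewrite rmorphM r0 mulr0.
by rewrite scaler_sumr; apply: eq_bigr => k _; rewrite scalerA.
Qed.

Lemma in_ker_smulB (x y : M) :
  in_ker_smul w x -> in_ker_smul w y -> in_ker_smul w (x - y).
Proof. by rewrite -scaleN1r => x0 /(in_ker_smulZ (-1)); apply: in_ker_smulD. Qed.

Lemma in_ker_smul_gen (a : A) (x : M) : w a = 0 -> in_ker_smul w (a *: x).
Proof.
by exists 1%N, (fun=> a), (fun=> x); split => //; rewrite big_ord_recl big_ord0 addr0.
Qed.

Lemma in_ker_smul_sum n (x : 'I_n -> M) :
  (forall k, in_ker_smul w (x k)) -> in_ker_smul w (\sum_(k < n) x k).
Proof.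
by move=> x0; apply: big_ind => //; [exact: in_ker_smul0|exact: in_ker_smulD].
Qed.

Lemma semilinear_ker_smul (N : lmodType B) (q : {linear M -> N | w \; *:%R}) x :
  in_ker_smul w x -> q x = 0.
Proof.
move=> [n [r [m [r0 ->]]]]; rewrite raddf_sum big1 // => k _.
by rewrite /= linearZ_LR /= r0 scale0r.
Qed.

(** The map [q] is semilinear along [w'], not along [w], because two different
kernels are compared: [ker w] on the source and [ker t] on the target. *)
Lemma in_ker_smul_map (B' C : pzRingType) (w' : {rmorphism A -> B'})
    (t : {rmorphism B' -> C}) (N : lmodType B')
    (q : {linear M -> N | w' \; *:%R}) x :
  (forall a, w a = 0 -> t (w' a) = 0) -> in_ker_smul w x -> in_ker_smul t (q x).
Proof.
move=> wt [n [r [m [r0 ->]]]]; exists n, (w' \o r), (q \o m); split.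
  by move=> k; apply: wt.
by rewrite raddf_sum; apply: eq_bigr => k _; rewrite /= linearZ_LR.
Qed.

(** Converse of [in_ker_smul_map]: both the coefficients and the vectors of a
combination are lifted, the former by assumption and the latter by surjectivity
of [q]. *)
Lemma in_ker_smul_lift (B' C : pzRingType) (w' : {rmorphism A -> B'})
    (t : {rmorphism B' -> C}) (N : lmodType B')
    (q : {linear M -> N | w' \; *:%R}) y :
  (forall b, t b = 0 -> exists2 a, w a = 0 & w' a = b) -> surjective q ->
  in_ker_smul t y -> exists2 x, in_ker_smul w x & q x = y.
Proof.
move=> lift q_surj [n [r [m [r0 ->]]]].
have exr k : exists a, w a = 0 /\ w' a = r k.
  by have [a] := lift _ (r0 k); exists a.
have [a aP] := choice exr.
have [s sP] := choice (fun k => q_surj (m k)).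
exists (\sum_(k < n) a k *: s k).
  by apply: in_ker_smul_sum => k; apply: in_ker_smul_gen; case: (aP k).
rewrite raddf_sum; apply: eq_bigr => k _.
by rewrite /= linearZ_LR /= sP; case: (aP k) => _ ->.
Qed.

End KerSmul.

(** * Reduction of a module along a surjective ring morphism *)

Definition is_reduction (A B : pzRingType) (w : {rmorphism A -> B})
    (M : lmodType A) (N : lmodType B) (q : M -> N) : Prop :=
  surjective q /\ forall x, q x = 0 <-> in_ker_smul w x.

Section ReductionExists.
Variables (A B : pzRingType) (w : {rmorphism A -> B}) (M : lmodType A).

Definition ker_smul : {pred M} := fun x => `[< in_ker_smul w x >].

Fact ker_smul_zmod_closed : zmod_closed ker_smul.
Proof.
split; first by apply/asboolP; apply: in_ker_smul0.
by move=> x y /asboolP x0 /asboolP y0; apply/asboolP; apply: in_ker_smulB.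
Qed.

HB.instance Definition _ :=
  GRing.isZmodClosed.Build M ker_smul ker_smul_zmod_closed.

(** The additive quotient [M / (ker w) M] becomes a [B]-module by letting [b]
act through any preimage under [w]: two preimages differ by an element of
[ker w], which sends [M] into [(ker w) M]. *)
Lemma reduction_exists : surjective w ->
  exists (N : lmodType B) (q : {linear M -> N | w \; *:%R}), is_reduction w q.
Proof.
move=> w_surj; pose Q := @Quotient.quot M ker_smul; pose q (x : M) : Q := (\pi_Q x)%qT.
have exw b : exists a, w a == b by have [a /eqP] := w_surj b; exists a.
pose sec b := xchoose (exw b).
have secK b : w (sec b) = b by exact/eqP/(xchooseP (exw b)).
have qE x y : q x = q y <-> in_ker_smul w (x - y).
  split=> [/eqP|xy]; first by rewrite -Quotient.idealrBE => /asboolP.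
  by apply/eqP; rewrite -Quotient.idealrBE; apply/asboolP.
have qD x y : q (x + y) = q x + q y by rewrite /q raddfD.
have reprK' (u : Q) : q (repr u) = u by exact: reprK.
pose sc b (u : Q) : Q := q (sec b *: repr u).
have scE a x : sc (w a) (q x) = q (a *: x).
  apply/qE; have -> : sec (w a) *: repr (q x) - a *: x
      = (sec (w a) - a) *: repr (q x) + a *: (repr (q x) - x).
    by rewrite scalerBl scalerBr addrA subrK.
  apply: in_ker_smulD; first by apply: in_ker_smul_gen; rewrite rmorphB secK subrr.
  by apply: in_ker_smulZ; apply/qE.
have scA b c u : sc b (sc c u) = sc (b * c) u.
  by rewrite -[b]secK -[c]secK -[u]reprK' -rmorphM !scE scalerA.
have sc1 : left_id 1 sc.
  by move=> u; rewrite -[u]reprK' -(rmorph1 w) scE scale1r.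
have scDr : right_distributive sc +%R.
  by move=> b u v; rewrite -[b]secK -[u]reprK' -[v]reprK' -qD !scE scalerDr qD.
have scDl u : {morph sc^~ u : b c / b + c}.
  by move=> b c; rewrite -[b]secK -[c]secK -[u]reprK' -rmorphD !scE scalerDl qD.
pose N : lmodType B := HB.pack Q (GRing.Zmodule_isLmodule.Build B Q scA sc1 scDr scDl).
have q_lin : linear_for (w \; *:%R) (q : M -> N).
  by move=> a x y; rewrite qD -scE.
pose q' : {linear M -> N | w \; *:%R} :=
  HB.pack (q : M -> N) (GRing.isLinear.Build A M N (w \; *:%R) q q_lin).
exists N, q'; split; first by move=> u; exists (repr u); apply: reprK'.
move=> x; rewrite -[x in in_ker_smul w x]subr0; split=> [qx0|/qE qx0].
  by apply/qE; rewrite -[RHS]/(q' 0) raddf0.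
by rewrite -(raddf0 q').
Qed.

End ReductionExists.

(** Universal property of a reduction.  The morphism [u] is kept apart from the
composite [t \o w] so that the two factorizations of [R -> Rbar] can be used
for one and the same map. *)
Lemma reduction_factor (A B C : pzRingType) (w : {rmorphism A -> B})
    (t : {rmorphism B -> C}) (u : {rmorphism A -> C})
    (M : lmodType A) (N : lmodType B) (P : lmodType C)
    (q : {linear M -> N | w \; *:%R}) (g : {linear M -> P | u \; *:%R}) :
  surjective w -> u =1 t \o w -> is_reduction w q ->
  exists h : {linear N -> P | t \; *:%R}, forall x, h (q x) = g x.
Proof.
move=> w_surj uE [q_surj q_ker].
have [sec secK] := choice q_surj.
have hE x : g (sec (q x)) = g x.
  apply/eqP; rewrite -subr_eq0 -raddfB; apply/eqP/semilinear_ker_smul.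
  have /q_ker : q (sec (q x) - x) = 0 by rewrite raddfB /= secK subrr.
  move=> [n [r [m [r0 ->]]]]; exists n, r, m; split => // k.
  by rewrite uE /= r0 raddf0.
have h_lin : linear_for (t \; *:%R) (g \o sec).
  move=> b y z; have [a <-] := w_surj b.
  have [[x <-] [x' <-]] := (q_surj y, q_surj z).
  have -> : w a *: q x + q x' = q (a *: x + x') by rewrite raddfD /= linearZ_LR.
  by rewrite /= !hE raddfD /= linearZ_LR /= uE.
pose h : {linear N -> P | t \; *:%R} := HB.pack (g \o sec)
  (GRing.isLinear.Build B N P (t \; *:%R) (g \o sec) h_lin).
by exists h.
Qed.

(** The universal property gives maps both ways; they are inverse to each other
since [q] and [q'] are surjective. *)
Lemma reduction_unique (A B : pzRingType) (w : {rmorphism A -> B})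
    (M : lmodType A) (N N' : lmodType B)
    (q : {linear M -> N | w \; *:%R}) (q' : {linear M -> N' | w \; *:%R}) :
  surjective w -> is_reduction w q -> is_reduction w q' ->
  exists2 h : {linear N -> N'}, bijective h & forall x, h (q x) = q' x.
Proof.
move=> w_surj q_red q_red'.
have [h hE] := @reduction_factor _ _ _ w idfun w _ _ _ q q' w_surj (frefl _) q_red.
have [k kE] := @reduction_factor _ _ _ w idfun w _ _ _ q' q w_surj (frefl _) q_red'.
exists h => //; exists k => y.
  by have [x <-] := q_red.1 y; rewrite hE kE.
by have [x <-] := q_red'.1 y; rewrite kE hE.
Qed.

(** If [p (q x) = 0], then [q x] is a combination with coefficients in [ker t].
Lifting it to [M] gives an element of [(ker u) M] which differs from [x] by an
element of [ker q = (ker w) M], and [ker w] is contained in [ker u]. *)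
Lemma reduction_comp (A B C : pzRingType) (w : {rmorphism A -> B})
    (t : {rmorphism B -> C}) (u : {rmorphism A -> C})
    (M : lmodType A) (N : lmodType B) (P : lmodType C)
    (q : {linear M -> N | w \; *:%R}) (p : {linear N -> P | t \; *:%R}) :
  surjective w -> u =1 t \o w -> is_reduction w q -> is_reduction t p ->
  exists2 g : {linear M -> P | u \; *:%R},
    is_reduction u g & forall x, g x = p (q x).
Proof.
move=> w_surj uE [q_surj q_ker] [p_surj p_ker].
have g_lin : linear_for (u \; *:%R) (p \o q).
  by move=> a x y; rewrite /= raddfD raddfD /= !linearZ_LR /= uE.
pose g : {linear M -> P | u \; *:%R} := HB.pack (p \o q)
  (GRing.isLinear.Build A M P (u \; *:%R) (p \o q) g_lin).
exists g => //; split.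
  by move=> z; have [y <-] := p_surj z; have [x <-] := q_surj y; exists x.
move=> x; split; last exact: semilinear_ker_smul.
move=> /p_ker qx0.
have lift b : t b = 0 -> exists2 a, u a = 0 & w a = b.
  by move=> tb0; have [a ab] := w_surj b; exists a => //; rewrite uE /= ab.
have [y y0 yx] := in_ker_smul_lift lift q_surj qx0.
rewrite -[x](subrK y); apply: in_ker_smulD => //.
have /q_ker : q (x - y) = 0 by rewrite raddfB /= yx subrr.
move=> [n [r [m [r0 ->]]]]; exists n, r, m; split => // k.
by rewrite uE /= r0 raddf0.
Qed.

(** A cancellation property complementing [reduction_comp]: an element of [ker p] lifts to
[ker g = (ker u) M], whose image lies in [(ker t) N]. *)
Lemma reduction_descent (A B C : pzRingType) (w : {rmorphism A -> B})
    (t : {rmorphism B -> C}) (u : {rmorphism A -> C})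
    (M : lmodType A) (N : lmodType B) (P : lmodType C)
    (q : {linear M -> N | w \; *:%R}) (p : {linear N -> P | t \; *:%R})
    (g : M -> P) :
  u =1 t \o w -> surjective q -> is_reduction u g ->
  (forall x, p (q x) = g x) -> is_reduction t p.
Proof.
move=> uE q_surj [g_surj g_ker] pqE; split.
  by move=> z; have [x <-] := g_surj z; exists (q x).
move=> y; split; last exact: semilinear_ker_smul.
have [x <-] := q_surj y; rewrite pqE => /g_ker.
by apply: in_ker_smul_map => a; rewrite uE.
Qed.

(** * Coordinates of a pullback module *)

(** A coordinate [g1] of a separated pullback is a reduction, in a form that
applies to both coordinates: where [g1] vanishes, the other coordinate is a
combination with coefficients in [ker v2], and these coefficients lift to
scalars killed by [rho1]. *)
Lemma reduction_coordinate (A A1 A2 C : pzRingType)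
    (rho1 : {rmorphism A -> A1}) (rho2 : {rmorphism A -> A2})
    (v2 : {rmorphism A2 -> C})
    (M : lmodType A) (N1 : lmodType A1) (N2 : lmodType A2) (P : lmodType C)
    (g1 : {linear M -> N1 | rho1 \; *:%R})
    (g2 : {linear M -> N2 | rho2 \; *:%R})
    (p2 : {linear N2 -> P | v2 \; *:%R}) :
  (forall c, v2 c = 0 -> exists2 a, rho1 a = 0 & rho2 a = c) ->
  is_reduction v2 p2 ->
  surjective g1 -> surjective g2 ->
  (forall x, g1 x = 0 -> g2 x = 0 -> x = 0) ->
  (forall x, g1 x = 0 -> p2 (g2 x) = 0) ->
  is_reduction rho1 g1.
Proof.
move=> lift [_ p2_ker] g1_surj g2_surj g_inj g12; split => // x; split.
  move=> x0; have /p2_ker g2x := g12 x x0.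
  have [y y0 yx] := in_ker_smul_lift lift g2_surj g2x.
  suff -> : x = y by [].
  apply/subr0_eq/g_inj; rewrite raddfB /= ?yx ?subrr //.
  by rewrite x0 (semilinear_ker_smul g1 y0) subrr.
exact: semilinear_ker_smul.
Qed.

Section Coordinates.
Variables (R1 R2 Rbar : pzRingType).
Variables (v1 : {rmorphism R1 -> Rbar}) (v2 : {rmorphism R2 -> Rbar}).

Definition pullback_ring_fst (r : pullback_ring v1 v2) : R1 := (val r).1.
Definition pullback_ring_snd (r : pullback_ring v1 v2) : R2 := (val r).2.

Fact pullback_ring_fst_zmod_morphism : zmod_morphism pullback_ring_fst.
Proof. by []. Qed.
Fact pullback_ring_fst_monoid_morphism : monoid_morphism pullback_ring_fst.
Proof. by []. Qed.
Fact pullback_ring_snd_zmod_morphism : zmod_morphism pullback_ring_snd.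
Proof. by []. Qed.
Fact pullback_ring_snd_monoid_morphism : monoid_morphism pullback_ring_snd.
Proof. by []. Qed.

HB.instance Definition _ := GRing.isZmodMorphism.Build
  (pullback_ring v1 v2) R1 pullback_ring_fst pullback_ring_fst_zmod_morphism.
HB.instance Definition _ := GRing.isMonoidMorphism.Build
  (pullback_ring v1 v2) R1 pullback_ring_fst pullback_ring_fst_monoid_morphism.
HB.instance Definition _ := GRing.isZmodMorphism.Build
  (pullback_ring v1 v2) R2 pullback_ring_snd pullback_ring_snd_zmod_morphism.
HB.instance Definition _ := GRing.isMonoidMorphism.Build
  (pullback_ring v1 v2) R2 pullback_ring_snd pullback_ring_snd_monoid_morphism.

Local Notation rho1 := pullback_ring_fst.
Local Notation rho2 := pullback_ring_snd.

Lemma pullback_ring_comm r : v1 (rho1 r) = v2 (rho2 r).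
Proof. by apply/eqP; exact: (valP r). Qed.

Lemma pullback_ring_pair a b :
  v1 a = v2 b -> exists2 r, rho1 r = a & rho2 r = b.
Proof.
move=> ab; have abP : in_pullback_ring v1 v2 (a, b) by apply/eqP.
by exists (PullbackRing abP).
Qed.

Lemma pullback_ring_fst_surj : surjective v2 -> surjective rho1.
Proof.
move=> v2_surj a; have [b ab] := v2_surj (v1 a).
by have [r ra _] := pullback_ring_pair (esym ab); exists r.
Qed.

Lemma pullback_ring_snd_surj : surjective v1 -> surjective rho2.
Proof.
move=> v1_surj b; have [a ab] := v1_surj (v2 b).
by have [r _ rb] := pullback_ring_pair ab; exists r.
Qed.

Lemma pullback_ring_bar_surj :
  surjective v1 -> surjective v2 -> surjective (v1 \o rho1).
Proof.
move=> v1_surj v2_surj c; have [a <-] := v1_surj c.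
by have [r <-] := pullback_ring_fst_surj v2_surj a; exists r.
Qed.

Lemma ker_fst_lift b : v2 b = 0 -> exists2 r, rho1 r = 0 & rho2 r = b.
Proof. by move=> b0; apply: pullback_ring_pair; rewrite raddf0. Qed.

Lemma ker_snd_lift a : v1 a = 0 -> exists2 r, rho2 r = 0 & rho1 r = a.
Proof.
by move=> a0; have [|r ra r0] := @pullback_ring_pair a 0; rewrite ?raddf0 //; exists r.
Qed.

(** A scalar [(a, b)] killed in [Rbar] is the sum of [(0, b)] and [(a, 0)]; each
summand is in the pullback ring because [v1 a = 0 = v2 b]. *)
Lemma ker_bar_split (S : lmodType (pullback_ring v1 v2)) (x : S) :
  in_ker_smul (v1 \o rho1) x ->
  exists y z, [/\ in_ker_smul rho1 y, in_ker_smul rho2 z & x = y + z].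
Proof.
move=> [n [r [m [r0 ->]]]].
have exa k : exists a, rho2 a = 0 /\ rho1 a = rho1 (r k).
  by have [a] := ker_snd_lift (r0 k); exists a.
have [a aP] := choice exa.
exists (\sum_(k < n) (r k - a k) *: m k), (\sum_(k < n) a k *: m k); split.
- apply: in_ker_smul_sum => k; apply: in_ker_smul_gen.
  by rewrite rmorphB /=; case: (aP k) => _ ->; rewrite subrr.
- by apply: in_ker_smul_sum => k; apply: in_ker_smul_gen; case: (aP k).
- by rewrite -big_split; apply: eq_bigr => k _; rewrite /= -scalerDl subrK.
Qed.

Section DiagramFor.
Variables (S : lmodType (pullback_ring v1 v2)) (D : pullback_diagram v1 v2).
Variable f : {linear S -> pullback D}.

Definition coord1 (s : S) : pd1 D := (val (f s)).1.
Definition coord2 (s : S) : pd2 D := (val (f s)).2.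

Fact coord1_linear : linear_for (rho1 \; *:%R) coord1.
Proof. by move=> a x y; rewrite /coord1 linearP. Qed.
Fact coord2_linear : linear_for (rho2 \; *:%R) coord2.
Proof. by move=> a x y; rewrite /coord2 linearP. Qed.

HB.instance Definition _ := GRing.isLinear.Build
  (pullback_ring v1 v2) S (pd1 D) (rho1 \; *:%R) coord1 coord1_linear.
HB.instance Definition _ := GRing.isLinear.Build
  (pullback_ring v1 v2) S (pd2 D) (rho2 \; *:%R) coord2 coord2_linear.

Lemma coord_comm s : pdmap1 D (coord1 s) = pdmap2 D (coord2 s).
Proof. by apply/eqP; exact: (valP (f s)). Qed.

Hypothesis f_bij : bijective f.

Lemma coord_inj s : coord1 s = 0 -> coord2 s = 0 -> s = 0.
Proof.
move=> s1 s2; apply: (bij_inj f_bij); rewrite raddf0; apply: val_inj => /=.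
by apply: injective_projections; [exact: s1|exact: s2].
Qed.

Lemma coord_pair x y :
  pdmap1 D x = pdmap2 D y -> exists2 s, coord1 s = x & coord2 s = y.
Proof.
move=> xy; have xyP : in_pullback (x, y) by apply/eqP.
have [g _ fK] := f_bij.
by exists (g (Pullback xyP)); rewrite /coord1 /coord2 fK.
Qed.

Hypothesis D_sep : separated D.

Lemma coord1_surj : surjective coord1.
Proof.
have [_ p2_surj _ _] := D_sep => x.
have [y xy] := p2_surj (pdmap1 D x).
by have [s sx _] := coord_pair (esym xy); exists s.
Qed.

Lemma coord2_surj : surjective coord2.
Proof.
have [p1_surj _ _ _] := D_sep => y.
have [x xy] := p1_surj (pdmap2 D y).
by have [s _ sy] := coord_pair xy; exists s.
Qed.

Lemma coord1_reduction : is_reduction rho1 coord1.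
Proof.
have [_ p2_surj _ p2_ker] := D_sep.
apply: (reduction_coordinate (g2 := coord2) ker_fst_lift (conj p2_surj p2_ker)).
- exact: coord1_surj.
- exact: coord2_surj.
- exact: coord_inj.
- by move=> s s1; rewrite -coord_comm s1 raddf0.
Qed.

Lemma coord2_reduction : is_reduction rho2 coord2.
Proof.
have [p1_surj _ p1_ker _] := D_sep.
apply: (reduction_coordinate (g2 := coord1) ker_snd_lift (conj p1_surj p1_ker)).
- exact: coord2_surj.
- exact: coord1_surj.
- by move=> s s2 s1; apply: coord_inj.
- by move=> s s2; rewrite coord_comm s2 raddf0.
Qed.

End DiagramFor.

(** * Existence and uniqueness of the separated diagram *)

Lemma ker_smul_meet (S : lmodType (pullback_ring v1 v2)) (x : S) :
  pullback_module S -> in_ker_smul rho1 x -> in_ker_smul rho2 x -> x = 0.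
Proof.
move=> [D [f f_bij]] x1 x2; apply: (coord_inj f_bij).
  exact: (semilinear_ker_smul (coord1 f) x1).
exact: (semilinear_ker_smul (coord2 f) x2).
Qed.

Hypotheses (v1_surj : surjective v1) (v2_surj : surjective v2).

Lemma separated_diagram_exists (S : lmodType (pullback_ring v1 v2)) :
  pullback_module S -> exists D, separated_diagram_for S D.
Proof.
move=> S_pb.
have rho1_surj := pullback_ring_fst_surj v2_surj.
have rho2_surj := pullback_ring_snd_surj v1_surj.
have rhobar_surj := pullback_ring_bar_surj v1_surj v2_surj.
have rhobarE : v1 \o rho1 =1 v2 \o rho2 by exact: pullback_ring_comm.
have [S1 [g1 g1_red]] := reduction_exists S rho1_surj.
have [S2 [g2 g2_red]] := reduction_exists S rho2_surj.
have [Sbar [g g_red]] := reduction_exists S rhobar_surj.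
have [p1 p1E] := reduction_factor g rho1_surj (frefl _) g1_red.
have [p2 p2E] := reduction_factor g rho2_surj rhobarE g2_red.
have [p1_surj p1_ker] := reduction_descent (frefl _) g1_red.1 g_red p1E.
have [p2_surj p2_ker] := reduction_descent rhobarE g2_red.1 g_red p2E.
pose D := PullbackDiagram p1 p2.
exists D; split => //.
have fP s : in_pullback (D := D) (g1 s, g2 s).
  by apply/eqP; rewrite /= p1E p2E.
pose f s : pullback D := Pullback (fP s).
have f_lin : linear f.
  by move=> a x y; apply: val_inj; rewrite /= !raddfD /= !linearZ_LR.
pose f' : {linear S -> pullback D} :=
  HB.pack f (GRing.isLinear.Build _ S (pullback D) *:%R f f_lin).
exists f'; apply: inj_surj_bijective.
  move=> x y [/eqP xy1 /eqP xy2]; apply/subr0_eq/ker_smul_meet => //.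
    by apply/g1_red.2/eqP; rewrite raddfB subr_eq0.
  by apply/g2_red.2/eqP; rewrite raddfB subr_eq0.
case=> -[x y] xyP; have [s sx] := g1_red.1 x; have [t ty] := g2_red.1 y.
have st0 : g (s - t) = 0.
  apply/eqP; rewrite raddfB subr_eq0 /= -p1E -p2E sx ty.
  exact: xyP.
(* If [s - t = b + c] with [g1 b = g2 c = 0], then [s - b = t + c] has the
   prescribed classes. *)
have [b [c [b0 c0 stE]]] := ker_bar_split ((g_red.2 _).1 st0).
exists (s - b); apply: val_inj; congr pair => /=.
  by rewrite raddfB /= sx (semilinear_ker_smul g1 b0) subr0.
have -> : s - b = t + c by apply/eqP; rewrite subr_eq -addrA [c + b]addrC -stE subrKC.
by rewrite raddfD /= ty (semilinear_ker_smul g2 c0) addr0.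
Qed.

Lemma separated_diagram_unique (S : lmodType (pullback_ring v1 v2))
    (D E : pullback_diagram v1 v2) :
  separated_diagram_for S D -> separated_diagram_for S E -> diagram_iso D E.
Proof.
move=> [[f f_bij] D_sep] [[g g_bij] E_sep].
have rho1_surj := pullback_ring_fst_surj v2_surj.
have rho2_surj := pullback_ring_snd_surj v1_surj.
have rhobar_surj := pullback_ring_bar_surj v1_surj v2_surj.
have f1_red := coord1_reduction f_bij D_sep.
have f2_red := coord2_reduction f_bij D_sep.
have g1_red := coord1_reduction g_bij E_sep.
have g2_red := coord2_reduction g_bij E_sep.
have [p1_surj _ p1_ker _] := D_sep; have [q1_surj _ q1_ker _] := E_sep.
have [fb fb_red fbE] := reduction_comp (u := v1 \o rho1) rho1_surj (frefl _)
  f1_red (conj p1_surj p1_ker).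
have [gb gb_red gbE] := reduction_comp (u := v1 \o rho1) rho1_surj (frefl _)
  g1_red (conj q1_surj q1_ker).
have [h1 h1_bij h1E] := reduction_unique rho1_surj f1_red g1_red.
have [h2 h2_bij h2E] := reduction_unique rho2_surj f2_red g2_red.
have [hb hb_bij hbE] := reduction_unique rhobar_surj fb_red gb_red.
exists h1, h2, hb; split => // x.
  by have [s <-] := f1_red.1 x; rewrite h1E -fbE hbE gbE.
by have [s <-] := f2_red.1 x; rewrite h2E -!coord_comm -fbE hbE gbE.
Qed.

End Coordinates.

Theorem theorem3p8 (R1 R2 Rbar : pzRingType)
    (v1 : {rmorphism R1 -> Rbar}) (v2 : {rmorphism R2 -> Rbar})
    (v1_surj : surjective v1) (v2_surj : surjective v2)
    (S : lmodType (pullback_ring v1 v2)) (S_pullback : pullback_module S) :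
  (exists D : pullback_diagram v1 v2, separated_diagram_for S D) /\
  (forall D E : pullback_diagram v1 v2,
     separated_diagram_for S D -> separated_diagram_for S E ->
     diagram_iso D E).
Proof.
split; first exact: separated_diagram_exists.
by move=> D E; apply: separated_diagram_unique.
Qed.
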